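(* Let $\{\omega_n\}_{n=1}^{+\infty}$ be a sequence of moduli of continuity (elements of $MC$). Let $T : [0,1]\to[0,1]$, $T(x) = 1 - |2x-1|$, be the tent map. The following conditions are equivalent: (i) For any metrizable space $X$ and any family $\mathcal{F} \subset X^X$ which is finitely equicontinuous with respect to some compatible metric on $X$, there exists a compatible metric $d$ on $X$ such that for any $n>0$ the family $\mathcal{F}^n$ admits the modulus $\omega_n$ (with respect to $d$). (ii) There exists a compatible metric $d$ on $[0,1]$ (with its usual topology) such that for any $n>0$ the function $T^n$ admits the modulus $\omega_n$ (with respect to $d$). (iii) There exists a sequence $\{\phi_n\}_{n=1}^{+\infty}$ of simple moduli of continuity such that: for any $n>0$ we have $1 < \phi_n'(0)$, and $\phi_n'(0) \to +\infty$ as $n \to +\infty$; there exists a constant $c>0$ such that $\sup \phi_n > c$ for any $n>0$; and $\phi_n(t) \leq \omega_n(t)$ for every $n>0$ and every $t \in [0,+\infty)$. (iv) There exists a constant $c>0$ such that for any real number $t>0$ we have $c < \liminf_{n\to+\infty} \omega_n(t)$, and $1 < \omega_n'(0)$ for any $n>0$.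
   Context: Let $\mathbb{R}_+ = [0,+\infty)$. A modulus of continuity is a function $\omega : \mathbb{R}_+\to\mathbb{R}_+$ such that: (MC1) $\omega(0) = 0 = \lim_{t\to0^+}\omega(t)$; (MC2) $\omega$ is nondecreasing; (MC3) the function $t \mapsto \omega(t)/t$ on $\mathbb{R}_+\setminus\{0\}$ is nonincreasing, i.e. $\omega(x)/x \geq \omega(y)/y$ whenever $0<x\leq y$. The set of all moduli of continuity is denoted $MC$. The derivative at $0$ of $\omega\in MC$ is $\omega'(0) := \lim_{t\to0^+} \omega(t)/t \in \mathbb{R}_+\cup\{+\infty\}$ (the limit always exists). A modulus of continuity $\omega$ is called simple if there exist $\alpha\in\mathbb{R}_+$ and $\beta\in\mathbb{R}_+\cup\{+\infty\}$ such that $\omega(t) = \min\{\alpha t,\beta\}$ for all $t\in\mathbb{R}_+$. A metric on a metrizable space is compatible if it induces the given topology. $X^X$ is the set of all functions from $X$ to $X$. For $\mathcal{F}\subset X^X$ and an integer $n>0$, $\mathcal{F}^n$ is the set of all compositions of $n$ functions from $\mathcal{F}$; for a function $f$, $f^n$ is its $n$-th iterate. Given a metric $d$ on $X$, a function $f : X\to X$ admits the modulus $\omega\in MC$ (with respect to $d$) if $d(f(x),f(y)) \leq \omega(d(x,y))$ for all $x,y\in X$; a family $\mathcal{F}\subset X^X$ admits $\omega$ if every member does. A family $\mathcal{G}\subset X^X$ is equicontinuous with respect to a compatible metric $\rho$ on $X$ if for any $x\in X$ and $\varepsilon>0$ there is a neighbourhood $U$ of $x$ such that $\mathrm{diam}_\rho(f(U))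 \leq \varepsilon$ for all $f\in\mathcal{G}$, where $\mathrm{diam}_\rho(A) = \sup\{\rho(x,y): x,y\in A\}$. A family $\mathcal{F}\subset X^X$ is finitely equicontinuous with respect to $\rho$ if $\mathcal{F}^n$ is equicontinuous with respect to $\rho$ for every integer $n>0$. *)

(* Defs.v *)
From HB Require Import structures.
From mathcomp Require Import all_boot all_order all_algebra.
From mathcomp Require Import all_classical all_reals all_analysis.
From mathcomp Require Import lra.

Set Implicit Arguments.
Unset Strict Implicit.
Unset Printing Implicit Defensive.

Import Order.TTheory GRing.Theory Num.Theory.
Import numFieldNormedType.Exports.

Local Open Scope classical_set_scope.
Local Open Scope ring_scope.

(* A function on [0, +oo[ is represented by a function on R; every condition
   is restricted to nonnegative arguments, so that values at negative reals
   are irrelevant. *)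
Record modulus (R : realType) (w : R -> R) : Prop := Modulus {
  modulus_ge0 : forall t, 0 <= t -> 0 <= w t;
  modulus0 : w 0 = 0;
  modulus_cvg0 : w t @[t --> 0^'+] --> 0;
  modulus_nondecreasing : forall s t, 0 <= s -> s <= t -> w s <= w t;
  modulus_ratio : forall s t, 0 < s -> s <= t -> w t / t <= w s / s
}.

Definition derivative0 (R : realType) (w : R -> R) : \bar R :=
  lim ((w t / t)%:E @[t --> 0^'+]).

Definition simple_modulus (R : realType) (w : R -> R) : Prop :=
  modulus w /\
  exists (a : R) (b : \bar R), [/\ 0 <= a, (0 <= b)%E &
    forall t, 0 <= t -> (w t)%:E = Order.min (a * t)%:E b].

Record is_metric (R : realType) (X : Type) (d : X -> X -> R) : Prop :=
  IsMetric {
    metric_ge0 : forall x y, 0 <= d x y;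
    metric_eq0 : forall x y, d x y = 0 <-> x = y;
    metric_symmetric : forall x y, d x y = d y x;
    metric_trans : forall x y z, d x z <= d x y + d y z
  }.

Definition compatible_metric (R : realType) (X : topologicalType)
    (d : X -> X -> R) : Prop :=
  is_metric d /\
  forall A : set X, open A <->
    forall x, A x -> exists2 e : R, 0 < e & [set y | d x y < e] `<=` A.

Definition metrizable (R : realType) (X : topologicalType) : Prop :=
  exists d : X -> X -> R, compatible_metric d.

(* Taken in \bar R: the supremum of an unbounded set would be 0 in R. *)
Definition diam (R : realType) (X : Type) (d : X -> X -> R) (A : set X) :
    \bar R :=
  ereal_sup [set (d p.1 p.2)%:E | p in A `*` A].

Fixpoint family_pow (X : Type) (F : set (X -> X)) (n : nat) : set (X -> X) :=
  if n is m.+1 then [set f \o g | f in F & g in family_pow F m] else [set id].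

Definition equicontinuous_wrt (R : realType) (X : topologicalType)
    (d : X -> X -> R) (G : set (X -> X)) : Prop :=
  forall (x : X) (e : R), 0 < e ->
    exists2 U : set X, nbhs x U &
      forall f, G f -> (diam d (f @` U) <= e%:E)%E.

Definition finitely_equicontinuous (R : realType) (X : topologicalType)
    (d : X -> X -> R) (F : set (X -> X)) : Prop :=
  forall n, (0 < n)%N -> equicontinuous_wrt d (family_pow F n).

Definition admits (R : realType) (X : Type) (d : X -> X -> R) (w : R -> R)
    (f : X -> X) : Prop :=
  forall x y, d (f x) (f y) <= w (d x y).

Definition family_admits (R : realType) (X : Type) (d : X -> X -> R)
    (w : R -> R) (F : set (X -> X)) : Prop :=
  forall f, F f -> admits d w f.

(* [set_type] carries the subspace topology inherited from R. *)
Definition unit_interval (R : realType) : topologicalType :=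
  set_type (`[0, 1]%classic : set R).

Lemma tent_itv (R : realType) (y : R) :
  0 <= y <= 1 -> 0 <= 1 - `|2 * y - 1| <= 1.
Proof.
by move=> /andP[y0 y1]; case: (ler0P (2 * y - 1)) => h; apply/andP; split; lra.
Qed.

Lemma tent_subproof (R : realType) (x : unit_interval R) :
  1 - `|2 * set_val x - 1| \in (`[0, 1]%classic : set R).
Proof.
have := set_valP x; rewrite inE /= !in_itv /=; exact: tent_itv.
Qed.

Definition tent (R : realType) (x : unit_interval R) : unit_interval R :=
  exist (fun y : R => y \in (`[0, 1]%classic : set R)) _ (tent_subproof x).

(* Main.v *)
Require Import Defs.
From mathcomp Require Import all_boot all_order all_algebra.
From mathcomp Require Import all_classical all_reals all_analysis.
From mathcomp Require Import lra.

(* Conditions (iii) and (iv) both say that min (a_n t) c <= omega_n t for some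
   c > 0 and some a_n > 1 tending to infinity: by (MC2) and (MC3) a modulus
   dominates the truncation at height omega s of the line through
   (s, omega s), for every s > 0.

   Given such a_n and c, the metric required by (i) is the supremum of
   min (rho (f x) (f y)) c / (a_m1 ... a_mk) over all lists m1, ..., mk of
   positive integers and all f in F^(m1 + ... + mk). Only finitely many values
   of m1 + ... + mk are compatible with a bound on a_m1 ... a_mk, so finite
   equicontinuity makes this metric compatible.

   Conversely, for (ii) it suffices to look at the points 0 and 2^-k: T^n fixes
   0 and maps 2^-(n+k) to 2^-k, while d(0, 2^-k) tends to 0. *)

Import Order.TTheory GRing.Theory Num.Theory.
Import numFieldNormedType.Exports.

Local Open Scope classical_set_scope.
Local Open Scope ring_scope.

Set Implicit Arguments.
Unset Strict Implicit.
Unset Printing Implicit Defensive.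

(** * Derivative at 0 of a modulus, and truncated lines below it *)

Section derivative_at_zero.
Variables (R : realType) (w : R -> R).
Hypothesis mw : modulus w.

(** By (MC3) the ratio [w t / t] grows as [t] decreases to 0, so its right limit exists and is its
    supremum. *)
Lemma derivative0E :
  derivative0 w = ereal_sup [set (w t / t)%:E | t in [set t | 0 < t]].
Proof.
rewrite /derivative0; apply: cvg_lim => //.
have -> : [set t : R | 0 < t] = [set` `]0, +oo[].
  by apply/seteqP; split=> t /=; rewrite in_itv /= andbT.
apply: (@nonincreasing_at_right_cvge R (fun t => (w t / t)%:E)) => //.
move=> s t; rewrite !in_itv /= !andbT => s0 t0 st.
by rewrite lee_fin; apply: (modulus_ratio mw).
Qed.

Lemma derivative0_ge t : 0 < t -> ((w t / t)%:E <= derivative0 w)%E.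
Proof. by move=> t0; rewrite derivative0E; apply: ereal_sup_ubound; exists t. Qed.

Lemma derivative0_le a :
  (forall t, 0 < t -> w t <= a * t) -> (derivative0 w <= a%:E)%E.
Proof.
move=> wa; rewrite derivative0E; apply: ge_ereal_sup => _ [t /= t0 <-].
by rewrite lee_fin ler_pdivrMr// wa.
Qed.

Lemma derivative0_gt a :
  (a%:E < derivative0 w)%E -> exists2 t, 0 < t & a < w t / t.
Proof.
rewrite derivative0E => /ereal_sup_gt[_ [t /= t0 <-]]; rewrite lte_fin.
by exists t.
Qed.

Lemma modulus_truncation s t : 0 < s -> 0 <= t ->
  Num.min (w s / s * t) (w s) <= w t.
Proof.
move=> s0; rewrite le_eqVlt => /predU1P[<-|t0].
  by rewrite (modulus0 mw) mulr0 ge_min lexx.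
case: (lerP t s) => [ts|/ltW st].
  by rewrite ge_min -ler_pdivlMr// (modulus_ratio mw).
by rewrite ge_min (modulus_nondecreasing mw (ltW s0) st) orbT.
Qed.

End derivative_at_zero.

(** * Truncated lines as simple moduli, and lower limits of real sequences *)

Lemma modulus_min (R : realType) (a c : R) : 0 <= a -> 0 <= c ->
  modulus (fun t => Num.min (a * t) c).
Proof.
move=> a0 c0; split.
- by move=> t t0; rewrite le_min c0 mulr_ge0.
- by rewrite mulr0 min_l.
- apply: (@squeeze_cvgr _ _ _ _ (fun=> 0) (fun t => a * t)).
  + near=> t; apply/andP; split; last by rewrite ge_min lexx.
    by rewrite le_min c0 mulr_ge0//.
  + exact: cvg_cst.
  + apply: cvg_at_right_filter; rewrite -[X in _ --> X](mulr0 a).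
    by apply: cvgMr; exact: cvg_id.
- move=> s t s0 st; rewrite le_min !ge_min lexx orbT andbT.
  by rewrite ler_wpM2l.
- move=> s t s0 st; have t0 := lt_le_trans s0 st.
  rewrite ler_pdivrMr// ge_min; case: (lerP (a * s) c) => asc.
    by rewrite mulfK ?gt_eqF// lexx.
  by rewrite -mulrA ler_peMr ?orbT// mulrC ler_pdivlMr// mul1r.
Unshelve. all: by end_near.
Qed.

Lemma simple_modulus_min (R : realType) (a c : R) : 0 <= a -> 0 <= c ->
  simple_modulus (fun t => Num.min (a * t) c).
Proof.
move=> a0 c0; split; first exact: modulus_min.
by exists a, c%:E; split=> // t _; rewrite EFin_min.
Qed.

Lemma limn_einf_gtP (R : realType) (u : nat -> R) (c : R) :
  (c%:E < limn_einf (fun n => (u n)%:E))%E -> \forall n \near \oo, c < u n.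
Proof.
rewrite limn_einf_lim (cvg_lim _ (@cvg_einfs_sup _ _))// => /ereal_sup_gt[_ [N _ <-]].
move=> cN; exists N => // n /= Nn; rewrite -lte_fin; apply: lt_le_trans cN _.
by apply: ereal_inf_lbound; exists n.
Qed.

Lemma limn_einf_ge (R : realType) (u : nat -> R) (c : R) :
  (\forall n \near \oo, c <= u n) -> (c%:E <= limn_einf (fun n => (u n)%:E))%E.
Proof.
move=> [N _ cu]; rewrite limn_einf_lim (cvg_lim _ (@cvg_einfs_sup _ _))//.
apply: (@le_trans _ _ (einfs (fun n => (u n)%:E) N)); last first.
  by apply: ereal_sup_ubound; exists N.
by apply: le_ereal_inf_tmp => _ [n /= Nn <-]; rewrite lee_fin cu.
Qed.

(** Pivot of the equivalences. Cutting all lines at one height [c] is what lets a single bounded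
    metric serve every [n]. *)
Definition truncated_minorant (R : realType) (omega : nat -> R -> R)
    (a : nat -> R) (c : R) : Prop :=
  [/\ 0 < c, forall n, (0 < n)%N -> 1 < a n, a n @[n --> \oo] --> +oo &
    forall n t, (0 < n)%N -> 0 <= t -> Num.min (a n * t) c <= omega n t].

(** * Truncated minorants compared with conditions (iii) and (iv) *)

Section modulus_sequence.
Variables (R : realType) (omega : nat -> R -> R).
Hypothesis momega : forall n, (0 < n)%N -> modulus (omega n).

(** The slope of [phi n] serves as [a n]: it bounds the derivative at 0 from above. The cap of
    [phi n] exceeds [c] because some value of [phi n] does. *)
Lemma truncated_minorant_simple (phi : nat -> R -> R) (c : R) : 0 < c ->
  (forall n, (0 < n)%N -> simple_modulus (phi n)) ->
  (forall n, (0 < n)%N -> (1 < derivative0 (phi n))%E) ->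
  derivative0 (phi n) @[n --> \oo] --> +oo%E ->
  (forall n, (0 < n)%N ->
    (c%:E < ereal_sup [set (phi n t)%:E | t in [set t | (0 <= t)%R]])%E) ->
  (forall n t, (0 < n)%N -> 0 <= t -> phi n t <= omega n t) ->
  exists a, truncated_minorant omega a c.
Proof.
move=> c0 sphi dphi1 dphioo supphi phiomega.
have /choice[a aP] n : exists a : R, (0 < n)%N -> exists2 b : \bar R, (0 <= b)%E &
    forall t, 0 <= t -> (phi n t)%:E = Order.min (a * t)%:E b.
  case: n => [|n]; first by exists 0.
  by have [_ [a [b [_ b0 abE]]]] := sphi n.+1 isT; exists a => _; exists b.
have da n : (0 < n)%N -> (derivative0 (phi n) <= (a n)%:E)%E.
  move=> n0; apply: derivative0_le; first exact: (sphi n n0).1.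
  have [b _ abE] := aP n n0 => t t0.
  by rewrite -lee_fin abE ?(ltW t0)// ge_min lexx.
exists a; split => //.
- by move=> n n0; rewrite -lte_fin (lt_le_trans (dphi1 n n0)) ?da.
- apply/cvgryPgt => K; near=> n; rewrite -lte_fin.
  apply: (@lt_le_trans _ _ (derivative0 (phi n))); last first.
    by apply: da; near: n; exact: nbhs_infty_gt.
  by near: n; exact: cvgey_gt.
- move=> n t n0 t0; apply: le_trans (phiomega n t n0 t0).
  have [b _ abE] := aP n n0; rewrite -lee_fin abE// EFin_min.
  rewrite le_min ge_min lexx/= ge_min; apply/orP; right.
  have /ereal_sup_gt[_ [s /= s0 <-]] := supphi n n0.
  by rewrite abE// lt_min => /andP[_ /ltW].
Unshelve. all: by end_near.
Qed.

Lemma simple_truncated_minorant (a : nat -> R) (c : R) :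
  truncated_minorant omega a c ->
  exists phi : nat -> R -> R,
      [/\ forall n, (0 < n)%N -> simple_modulus (phi n),
          (forall n, (0 < n)%N -> (1 < derivative0 (phi n))%E) /\
            (derivative0 (phi n) @[n --> \oo] --> +oo%E),
          exists c : R, 0 < c /\
            forall n, (0 < n)%N ->
              (c%:E < ereal_sup [set (phi n t)%:E | t in [set t | (0 <= t)%R]])%E
        & forall n t, (0 < n)%N -> 0 <= t -> phi n t <= omega n t].
Proof.
move=> [c0 a1 aoo min_le]; exists (fun n t => Num.min (a n * t) c).
have sphi n : (0 < n)%N -> simple_modulus (fun t => Num.min (a n * t) c).
  by move=> n0; apply: simple_modulus_min; rewrite ltW// (lt_trans ltr01 (a1 n n0)).
have da n : (0 < n)%N ->
    ((a n)%:E <= derivative0 (fun t => Num.min (a n * t)%R c))%E.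
  move=> n0; have an0 := lt_trans ltr01 (a1 n n0).
  (* The two branches of the minimum meet at [c / a n], where the ratio is exactly [a n]. *)
  have ca0 : 0 < c / a n by rewrite divr_gt0.
  apply: le_trans (derivative0_ge (sphi n n0).1 ca0).
  have -> : a n * (c / a n) = c by rewrite mulrC mulfVK ?gt_eqF.
  by rewrite minxx lee_fin invf_div mulrC mulfVK ?gt_eqF.
split => //.
- split=> [n n0|].
    by apply: lt_le_trans (da n n0); rewrite lte_fin a1.
  apply/cvgeyPgt => K; near=> n.
  apply: (@lt_le_trans _ _ (a n)%:E).
    by rewrite lte_fin; near: n; move/cvgryPgt : aoo; exact.
  by apply: da; near: n; exact: nbhs_infty_gt.
(* The height [c] is attained; halving it gives the strict inequality. *)
- exists (c / 2); split=> [|n n0]; first by rewrite divr_gt0.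
  have an0 := lt_trans ltr01 (a1 n n0).
  apply: (@lt_le_trans _ _ c%:E); first by rewrite lte_fin; lra.
  apply: ereal_sup_ubound; exists (c / a n) => /=; first by rewrite divr_ge0 ?ltW.
  by rewrite mulrC mulfVK ?gt_eqF// minxx.
Unshelve. all: by end_near.
Qed.

(** For fixed [t] the minimum equals [c] once [a n] exceeds [c / t]. The derivative is tested at the
    corner [c / a n], where the ratio is at least [a n]. *)
Lemma liminf_truncated_minorant (a : nat -> R) (c : R) :
  truncated_minorant omega a c ->
  (exists c : R, 0 < c /\
     forall t : R, 0 < t -> (c%:E < limn_einf (fun n => (omega n t)%:E))%E) /\
  forall n, (0 < n)%N -> (1 < derivative0 (omega n))%E.
Proof.
move=> [c0 a1 aoo min_le]; split.
  exists (c / 2); split=> [|t t0]; first by rewrite divr_gt0.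
  apply: (@lt_le_trans _ _ c%:E); first by rewrite lte_fin; lra.
  apply: limn_einf_ge; near=> n.
  have n0 : (0 < n)%N by near: n; exact: nbhs_infty_gt.
  apply: le_trans (min_le n t n0 (ltW t0)).
  rewrite le_min lexx andbT -ler_pdivrMr// ltW//.
  by near: n; move/cvgryPgt : aoo; exact.
move=> n n0; have an0 := lt_trans ltr01 (a1 n n0).
have ca0 : 0 < c / a n by rewrite divr_gt0.
apply: lt_le_trans (derivative0_ge (momega n0) ca0).
rewrite lte_fin ltr_pdivlMr// mul1r.
apply: lt_le_trans (min_le n _ n0 (ltW ca0)).
have -> : a n * (c / a n) = c by rewrite mulrC mulfVK ?gt_eqF.
rewrite minxx ltr_pdivrMr// ltr_pMr//; exact: a1.
Unshelve. all: by end_near.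
Qed.

(* [s n] is a point where [omega n] takes a value above a fixed constant; taking
   [s n] as small as [omega n] allows makes the slopes [omega n (s n) / s n]
   tend to infinity. *)
Lemma truncated_minorant_liminf (c : R) : 0 < c ->
  (forall t : R, 0 < t -> (c%:E < limn_einf (fun n => (omega n t)%:E))%E) ->
  (forall n, (0 < n)%N -> (1 < derivative0 (omega n))%E) ->
  exists a c, truncated_minorant omega a c.
Proof.
move=> c0 climinf domega1.
pose P n k := c < omega n k.+1%:R^-1.
(* The search stops at [n] to stay finite. The maximum over no index is 0, so [P n (k n)] is claimed
   for large [n] only. *)
pose k n := (\max_(i < n | P n i) i)%N.
have kP K : \forall n \near \oo, (K <= k n)%N /\ P n (k n).
  near=> n.
  have Kn : (K < n)%N by near: n; exact: nbhs_infty_gt.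
  have PnK : P n K.
    by near: n; apply: limn_einf_gtP; apply: climinf; rewrite invr_gt0 ltr0n.
  split; first exact: (bigop.bigmax_sup (Ordinal Kn)).
  have [|i Pi kE] := @eq_bigmax_cond _ [pred i : 'I_n | P n i] (@nat_of_ord n).
    by apply/card_gt0P; exists (Ordinal Kn).
  by have -> : k n = i := kE.
(* Once [k n >= K > 1 / c], the slope at [1 / (k n + 1)], which is above [c * (k n + 1)], exceeds
   1. *)
have [K cK] : exists K : nat, c^-1 < K%:R.
  by exists (Num.bound c^-1); rewrite archi_boundP// invr_ge0 ltW.
have [N _ NP] := kP K.
have slope n : (N <= n)%N -> c * (k n).+1%:R < omega n (k n).+1%:R^-1 * (k n).+1%:R.
  by move=> Nn; rewrite ltr_pM2r//; exact: (NP n Nn).2.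
have slope1 n : (N <= n)%N -> 1 < c * (k n).+1%:R.
  move=> Nn; rewrite -ltr_pdivrMl// mulr1 (lt_le_trans cK)// ler_nat.
  exact: leq_trans (NP n Nn).1 _.
(* For the finitely many positive [n] below [N], the point comes from [1 < derivative0 (omega n)]
   instead. *)
have /choice[s sP] n : exists s : R, (0 < n)%N ->
    [/\ 0 < s, 1 < omega n s / s & (N <= n)%N -> s = (k n).+1%:R^-1].
  case: (leqP N n) => Nn.
    exists (k n).+1%:R^-1 => n0; rewrite invr_gt0 ltr0n; split=> //.
    by rewrite invrK (lt_trans (slope1 n Nn))// slope.
  case: n Nn => [|n] Nn; first by exists 0.
  have [s s0 s1] := derivative0_gt (momega (ltn0Sn n)) (domega1 n.+1 isT).
  by exists s => _; split=> //; rewrite leqNgt Nn.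
(* From [N] on the heights exceed [c]; only finitely many others can lower the common cut-off. *)
pose c' := \big[Num.min/c]_(i < N | (0 < i)%N) omega i (s i).
exists (fun n => omega n (s n) / s n), c'; split.
- apply: lt_bigmin => // i i0; have [s0 s1 _] := sP i i0.
  by rewrite -(pmulr_lgt0 _ (_ : 0 < (s i)^-1)) ?invr_gt0// (lt_trans ltr01).
- by move=> n n0; have [] := sP n n0.
- apply/cvgryPgt => A; near=> n.
  have n0 : (0 < n)%N by near: n; exact: nbhs_infty_gt.
  have Nn : (N <= n)%N by near: n; exact: nbhs_infty_ge.
  have [_ _ ->//] := sP n n0; rewrite invrK (lt_trans _ (slope n Nn))//.
  rewrite -ltr_pdivrMl//; apply: (@lt_le_trans _ _ (Num.bound `|c^-1 * A|)%:R).
    by rewrite (le_lt_trans (ler_norm _))// archi_boundP.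
  rewrite ler_nat; apply: (@leq_trans (k n)) => //.
  by near: n; apply: filterS (kP (Num.bound `|c^-1 * A|)) => n [].
- move=> n t n0 t0; have [s0 _ sE] := sP n n0.
  apply: le_trans (modulus_truncation (momega n0) s0 t0).
  rewrite le_min !ge_min lexx/=; apply/orP; right.
  case: (ltnP n N) => Nn; first exact: (bigmin_le_cond _ (j := Ordinal Nn)).
  rewrite sE//; apply: (@le_trans _ _ c); first exact: bigmin_le_id.
  exact: ltW (NP n Nn).2.
Unshelve. all: by end_near.
Qed.

End modulus_sequence.

(** * Diameters, compatible metrics and powers of a family *)

Lemma diam_leP (R : realType) (X : Type) (d : X -> X -> R) (A : set X) (e : R) :
  (diam d A <= e%:E)%E <-> forall x y, A x -> A y -> d x y <= e.
Proof.
split=> [dA x y Ax Ay|dA].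
  by rewrite -lee_fin (le_trans _ dA)//; apply: ereal_sup_ubound; exists (x, y).
by apply: ge_ereal_sup => _ [[x y] [/= Ax Ay] <-]; rewrite lee_fin dA.
Qed.

Lemma compatible_metric_nbhsP (R : realType) (X : topologicalType)
    (d : X -> X -> R) (x : X) (U : set X) : compatible_metric d ->
  nbhs x U <-> exists2 e, 0 < e & [set y | d x y < e] `<=` U.
Proof.
move=> [md dP]; split=> [|[e e0 eU]].
  rewrite nbhsE => -[B [oB Bx] BU].
  by have [e e0 eB] := (dP B).1 oB x Bx; exists e => // y /eB/BU.
rewrite nbhsE; exists [set y | d x y < e] => //; split=> /=.
  apply/dP => y /= dxy; exists (e - d x y); first by rewrite subr_gt0.
  by move=> z /= dyz; have := metric_trans md x y z; lra.
by rewrite ((metric_eq0 md x x).2 erefl).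
Qed.

Lemma family_pow_comp (X : Type) (F : set (X -> X)) n m f g :
  family_pow F n f -> family_pow F m g -> family_pow F (n + m) (f \o g).
Proof.
elim: n f => [|n IHn] f /=; first by move=> ->.
move=> [h Fh [k Fk <-]] Fg; exists h => //; exists (k \o g) => //.
exact: IHn.
Qed.

Lemma family_pow_set1 (X : Type) (f : X -> X) n :
  family_pow [set f] n = [set iter n f].
Proof.
elim: n => [//|n IHn] /=; rewrite IHn; apply/seteqP; split=> [_ [_ -> [_ -> <-]]//|].
by move=> _ ->; exists f => //; exists (iter n f).
Qed.

Lemma bernoulli_le (R : realDomainType) (q : R) n :
  1 <= q -> 1 + n%:R * (q - 1) <= q ^+ n.
Proof.
move=> q1; elim: n => [|n IHn]; first by rewrite mul0r addr0 expr0.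
have n0 : 0 <= n%:R :> R by [].
rewrite exprS (le_trans _ (ler_wpM2l _ IHn)) ?(le_trans _ q1)//.
have : 0 <= n%:R * (q - 1) * (q - 1) by rewrite !mulr_ge0// subr_ge0.
by rewrite -natr1; lra.
Qed.

(** * Products of slopes over lists *)

Section products.
Variables (R : realType) (a : nat -> R).
Hypotheses (a1 : forall n, (0 < n)%N -> 1 < a n) (aoo : a n @[n --> \oo] --> +oo).

Lemma prod_ge1 l : all (ltn 0) l -> 1 <= \prod_(n <- l) a n.
Proof.
elim: l => [|n l IHl] /=; first by rewrite big_nil.
move=> /andP[n0 l0]; rewrite big_cons.
by apply: mulr_ege1; [exact: ltW (a1 n0) | exact: IHl].
Qed.

Lemma ler_prod_mem l n : all (ltn 0) l -> n \in l -> a n <= \prod_(m <- l) a m.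
Proof.
elim: l => [//|m l IHl] /= /andP[m0 l0]; rewrite inE big_cons => /predU1P[->|nl].
  by rewrite ler_peMr ?prod_ge1// ltW// (lt_trans ltr01)// a1.
have am1 := a1 m0; apply: (le_trans (IHl l0 nl)).
rewrite ler_peMl// ?(ltW am1)//; exact: le_trans ler01 (prod_ge1 l0).
Qed.

Lemma exp_le_prod q l : 0 <= q -> (forall n, (0 < n)%N -> q <= a n) ->
  all (ltn 0) l -> q ^+ size l <= \prod_(n <- l) a n.
Proof.
move=> q0 qa; elim: l => [|n l IHl] /=; first by rewrite big_nil.
move=> /andP[n0 l0]; rewrite big_cons exprS.
by rewrite ler_pM ?exprn_ge0 ?qa ?IHl.
Qed.

(** Beyond some index [a n > 2], and the finitely many earlier values have a minimum above 1. The
    bound must be uniform for long products to be large. *)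
Lemma lower_bound_gt1 : exists2 q, 1 < q & forall n, (0 < n)%N -> q <= a n.
Proof.
have [N _ aN] : \forall n \near \oo, 2 < a n by move/cvgryPgt : aoo; exact.
exists (\big[Num.min/2]_(i < N | (0 < i)%N) a i).
  by apply: lt_bigmin => [|i i0]; [rewrite ltr1n | exact: a1].
move=> n n0; case: (ltnP n N) => nN; first exact: (bigmin_le_cond _ (j := Ordinal nN)).
exact: le_trans (bigmin_le_id _ _ _ _) (ltW (aN n nN)).
Qed.

Lemma sumn_le_size l M : {in l, forall n, (n <= M)%N} -> (sumn l <= M * size l)%N.
Proof.
elim: l => [//|n l IHl] lM /=; rewrite mulnS leq_add ?lM ?mem_head//.
by apply: IHl => m ml; apply: lM; rewrite inE ml orbT.
Qed.

(* A list with a small product has bounded entries, because [a] tends to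
   infinity, and bounded length, because [a] is bounded away from 1. *)
Lemma prod_gt_of_large_sum K : exists B : nat, forall l,
  all (ltn 0) l -> (B < sumn l)%N -> K < \prod_(n <- l) a n.
Proof.
have [q q1 qa] := lower_bound_gt1.
have q0 : 0 <= q - 1 by rewrite subr_ge0 ltW.
have [M _ aM] : \forall n \near \oo, K < a n by move/cvgryPgt : aoo; exact.
(* Chosen so that Bernoulli's inequality gives [q ^+ L >= 1 + L * (q - 1) > K]. *)
pose L := Num.bound (`|K| / (q - 1)).
have qL : K < q ^+ L.
  apply: lt_le_trans (bernoulli_le L (ltW q1)).
  rewrite ltr_wpDl// -ltr_pdivrMr ?subr_gt0//.
  apply: (@le_lt_trans _ _ (`|K| / (q - 1))).
    by rewrite ler_wpM2r ?invr_ge0// ler_norm.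
  by rewrite archi_boundP// divr_ge0.
(* If no entry reaches [M], a sum above [M * L] forces more than [L] entries. *)
exists (M * L)%N => l l0 lB.
case: (boolP (has (leq M) l)) => [/hasP[n nl /= Mn]|/hasPn lM].
  by apply: lt_le_trans (ler_prod_mem l0 nl); exact: aM.
apply: (lt_le_trans qL); apply: le_trans (exp_le_prod _ qa l0); last lra.
rewrite ler_weXn2l ?(ltW q1)// ltnW//.
have := leq_trans lB (@sumn_le_size l M _).
by rewrite ltn_mul2l => /(_ _)/andP[] // n /lM; rewrite -ltnNge => /ltnW.
Qed.

End products.

(** * The metric required by (i) *)

Section orbit_metric.
Variables (R : realType) (X : Type) (rho : X -> X -> R) (F : set (X -> X)).
Variables (a : nat -> R) (c : R).
Hypothesis mrho : is_metric rho.
Hypotheses (c0 : 0 < c) (a1 : forall n, (0 < n)%N -> 1 < a n).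

(** Cutting [rho] at [c] keeps this set bounded, so that its [sup] is a genuine supremum. *)
Definition orbit_values (x y : X) : set R :=
  [set r | exists l f, [/\ all (ltn 0) l, family_pow F (sumn l) f &
    r = Num.min (rho (f x) (f y)) c / \prod_(n <- l) a n]].

(* Composing [f] with [g] in [F^m] prepends [m] to [l], which costs exactly a
   factor [a m]; this is why the supremum ranges over lists [l] rather than
   over the lengths [sumn l]. *)
Definition orbit_metric (x y : X) : R := sup (orbit_values x y).

Let prod_gt0 l : all (ltn 0) l -> 0 < \prod_(n <- l) a n.
Proof. by move=> l0; rewrite (lt_le_trans ltr01)// prod_ge1. Qed.

Let min_ge0 x y : 0 <= Num.min (rho x y) c.
Proof. by rewrite le_min metric_ge0// ltW. Qed.

Lemma orbit_value_le l (f : X -> X) x y : all (ltn 0) l ->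
  Num.min (rho (f x) (f y)) c / \prod_(n <- l) a n <= Num.min (rho (f x) (f y)) c.
Proof.
by move=> l0; rewrite ler_pdivrMr ?prod_gt0// ler_peMr ?prod_ge1.
Qed.

Lemma orbit_metric_ge l f x y : all (ltn 0) l -> family_pow F (sumn l) f ->
  Num.min (rho (f x) (f y)) c / \prod_(n <- l) a n <= orbit_metric x y.
Proof.
move=> l0 Ff; apply: ub_le_sup; last by exists l, f.
exists c => _ [l' [f' [l'0 _ ->]]]; apply: (le_trans (orbit_value_le _ _ _ l'0)).
by rewrite ge_min lexx orbT.
Qed.

Lemma orbit_metric_le r x y :
  (forall l f, all (ltn 0) l -> family_pow F (sumn l) f ->
    Num.min (rho (f x) (f y)) c / \prod_(n <- l) a n <= r) ->
  orbit_metric x y <= r.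
Proof.
move=> dr; apply: ge_sup; last by move=> _ [l [f [l0 Ff ->]]]; exact: dr.
by exists (Num.min (rho x y) c / \prod_(n <- [::]) a n), [::], id.
Qed.

(** The empty list with [id] contributes the truncated [rho] itself. This yields separation of
    points and one half of compatibility. *)
Lemma min_le_orbit_metric x y : Num.min (rho x y) c <= orbit_metric x y.
Proof.
by have := @orbit_metric_ge [::] id x y isT erefl; rewrite big_nil divr1.
Qed.

Lemma orbit_metric_bounded x y : orbit_metric x y <= c.
Proof.
apply: orbit_metric_le => l f l0 _; apply: (le_trans (orbit_value_le _ _ _ l0)).
by rewrite ge_min lexx orbT.
Qed.

Lemma is_metric_orbit_metric : is_metric orbit_metric.
Proof.
split.
- by move=> x y; exact: le_trans (min_ge0 x y) (min_le_orbit_metric x y).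
- move=> x y; split=> [d0|->].
    apply/(metric_eq0 mrho); apply/eqP; rewrite eq_le metric_ge0// andbT.
    by have := min_le_orbit_metric x y; rewrite d0 ge_min [c <= 0]leNgt c0 orbF.
  apply/eqP; rewrite eq_le; apply/andP; split.
    apply: orbit_metric_le => l f l0 _.
    by rewrite ((metric_eq0 mrho _ _).2 erefl) (min_l (ltW c0)) mul0r.
  exact: le_trans (min_ge0 y y) (min_le_orbit_metric y y).
- move=> x y; apply/eqP; rewrite eq_le; apply/andP.
  by split; apply: orbit_metric_le => l f l0 Ff; rewrite (metric_symmetric mrho);
    exact: orbit_metric_ge.
(* Truncation at [c] preserves the triangle inequality, and the supremum inherits it. *)
- move=> x y z; apply: orbit_metric_le => l f l0 Ff.
  apply: le_trans (lerD (orbit_metric_ge x y l0 Ff) (orbit_metric_ge y z l0 Ff)).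
  rewrite -mulrDl ler_pM2r ?invr_gt0 ?prod_gt0//.
  have := metric_trans mrho (f x) (f y) (f z).
  have := c0; have := metric_ge0 mrho (f x) (f y); have := metric_ge0 mrho (f y) (f z).
  by case: (lerP (rho (f x) (f y)) c); case: (lerP (rho (f y) (f z)) c);
    case: (lerP (rho (f x) (f z)) c); move=> *; lra.
Qed.

Lemma orbit_metric_expansion n g x y : (0 < n)%N -> family_pow F n g ->
  orbit_metric (g x) (g y) <= a n * orbit_metric x y.
Proof.
move=> n0 Fg; apply: orbit_metric_le => l f l0 Ff.
have an0 : 0 < a n by rewrite (lt_trans ltr01)// a1.
have : all (ltn 0) (n :: l) by rewrite /= n0.
move=> /(@orbit_metric_ge (n :: l) (f \o g) x y)/=.
rewrite addnC big_cons invfM mulrCA ler_pdivrMl//; apply.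
exact: family_pow_comp.
Qed.

End orbit_metric.

Lemma compatible_orbit_metric (R : realType) (X : topologicalType)
    (rho : X -> X -> R) (F : set (X -> X)) (a : nat -> R) (c : R) :
  compatible_metric rho -> finitely_equicontinuous rho F -> 0 < c ->
  (forall n, (0 < n)%N -> 1 < a n) -> a n @[n --> \oo] --> +oo ->
  compatible_metric (orbit_metric rho F a c).
Proof.
move=> crho eqF c0 a1 aoo; have mrho := crho.1.
split; first exact: is_metric_orbit_metric.
move=> A; split=> [oA x Ax|dA].
  have [e e0 eA] := (crho.2 A).1 oA x Ax.
  (* Below [c] the truncation has no effect, so a small orbit distance bounds [rho]. *)
  exists (Num.min e c); first by rewrite lt_min e0.
  move=> y /= dxy; apply: eA => /=.
  have := le_lt_trans (min_le_orbit_metric F mrho c0 a1 x y) dxy.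
  by case: (lerP (rho x y) c) => _; rewrite lt_min ?ltxx ?andbF// => /andP[].
rewrite openE => x Ax; have [e e0 eA] := dA x Ax.
(* Lists with sum above [B] then contribute at most [c / (c / (e / 2)) = e / 2]. *)
have [B BP] := prod_gt_of_large_sum a1 aoo (c / (e / 2)).
have e20 : 0 < e / 2 by rewrite divr_gt0.
have eq n : \forall y \near x, forall f, family_pow F n f -> rho (f x) (f y) <= e / 2.
  (* Finite equicontinuity starts at the first power; the power 0 is the identity alone. *)
  case: n => [|n].
    apply/(compatible_metric_nbhsP _ _ crho); exists (e / 2) => //.
    by move=> y /= xy _ ->; exact: ltW.
  have [U xU UP] := eqF n.+1 isT x _ e20.
  near=> y => f Ff; have /diam_leP := UP f Ff; apply; [exists x|exists y] => //.
    exact: nbhs_singleton.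
  by near: y.
(* Finitely many powers remain, so one neighbourhood of [x] serves them all. *)
have : \forall y \near x, forall (n : 'I_B.+1) f, family_pow F n f ->
    rho (f x) (f y) <= e / 2 by apply: filter_forall => n; exact: eq.
apply: filterS => y yP; apply: eA => /=.
apply: (@le_lt_trans _ _ (e / 2)); last lra.
apply: orbit_metric_le => l f l0 Ff.
case: (leqP (sumn l) B) => [|/BP cl].
  rewrite -ltnS => lB; apply: (le_trans (orbit_value_le mrho c0 a1 f x y l0)).
  by rewrite ge_min (yP (Ordinal lB))//.
have p0 : 0 < \prod_(n <- l) a n by rewrite (lt_le_trans ltr01)// prod_ge1.
rewrite ler_pdivrMr//; apply: (@le_trans _ _ c); first by rewrite ge_min lexx orbT.
by rewrite mulrC -ler_pdivrMr// ltW// cl.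
Unshelve. all: by end_near.
Qed.

(** The bound [c] on the metric and the expansion factor [a n] are the two branches of the
    minorant. *)
Lemma remetrization (R : realType) (omega : nat -> R -> R)
    (a : nat -> R) (c : R) (X : topologicalType)
    (rho : X -> X -> R) (F : set (X -> X)) :
  truncated_minorant omega a c ->
  compatible_metric rho -> finitely_equicontinuous rho F ->
  exists d : X -> X -> R, compatible_metric d /\
    forall n, (0 < n)%N -> family_admits d (omega n) (family_pow F n).
Proof.
move=> [c0 a1 aoo min_le] crho eqF; exists (orbit_metric rho F a c).
have cd := compatible_orbit_metric crho eqF c0 a1 aoo; split=> // n n0 f Ff x y.
apply: le_trans (min_le n _ n0 (metric_ge0 cd.1 x y)).
rewrite le_min orbit_metric_expansion ?orbit_metric_bounded//; exact: crho.1.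
Qed.


(** * The tent map and its iterates *)

Section tent_map.
Variable R : realType.
Local Notation I := (unit_interval R).

Definition interval_metric (x y : I) : R := `|set_val x - set_val y|.

Lemma compatible_interval_metric : compatible_metric interval_metric.
Proof.
split; first split.
- by move=> x y; exact: normr_ge0.
- move=> x y; split=> [/eqP|->]; last by rewrite /interval_metric subrr normr0.
  by rewrite normr_eq0 subr_eq0 => /eqP /val_inj.
- by move=> x y; exact: distrC.
- by move=> x y z; exact: ler_distD.
move=> A; split=> [[B oB <-] x /= Bx|dA].
  have /nbhs_ballP[e e0 eB] : nbhs (set_val x) B by exact: open_nbhs_nbhs.
  by exists e => // y xy; apply: eB; exact: xy.
rewrite openE => x Ax; have [e e0 eA] := dA x Ax.
have cval : continuous (set_val : I -> R) := @initial_continuous _ _ set_val.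
apply: (@filterS _ (nbhs x) _ _ _ _ (cval x _ (nbhsx_ballx (set_val x : R) e e0))) => y xy.
by apply: eA; exact: xy.
Qed.

Lemma tent_lipschitz (x y : I) :
  interval_metric (tent x) (tent y) <= 2 * interval_metric x y.
Proof.
rewrite /interval_metric /=.
set u := set_val x; set v := set_val y.
have -> : 1 - `|2 * u - 1| - (1 - `|2 * v - 1|) = `|2 * v - 1| - `|2 * u - 1| by lra.
apply: (le_trans (ler_dist_dist _ _)).
have -> : 2 * v - 1 - (2 * u - 1) = 2 * (v - u) by lra.
by rewrite normrM ger0_norm// distrC.
Qed.

Lemma iter_tent_lipschitz n (x y : I) :
  interval_metric (iter n (@tent R) x) (iter n (@tent R) y) <=
    2 ^+ n * interval_metric x y.
Proof.
elim: n => [|n IHn]; first by rewrite expr0 mul1r.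
by rewrite (le_trans (tent_lipschitz _ _))// exprS -mulrA ler_pM2l.
Qed.

Lemma finitely_equicontinuous_tent :
  finitely_equicontinuous interval_metric [set @tent R].
Proof.
move=> n _ x e e0; rewrite family_pow_set1.
(* The iterate is Lipschitz with constant [2 ^+ n]; the extra 2 passes from radius to diameter. *)
have p0 : 0 < 2 ^+ n * 2 :> R by rewrite mulr_gt0 ?exprn_gt0.
exists [set y | interval_metric x y < e / (2 ^+ n * 2)].
  apply/(compatible_metric_nbhsP _ _ compatible_interval_metric).
  by exists (e / (2 ^+ n * 2)) => //; rewrite divr_gt0.
move=> _ ->; apply/diam_leP => _ _ [y /= xy <-] [z /= xz <-].
apply: (le_trans (iter_tent_lipschitz n y z)).
have := metric_trans compatible_interval_metric.1 y x z.
rewrite (metric_symmetric compatible_interval_metric.1 y x).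
move: xy xz; rewrite !ltr_pdivlMr// => xy xz yz.
apply: (@le_trans _ _ (2 ^+ n * (interval_metric x y + interval_metric x z))).
  by rewrite ler_pM2l ?exprn_gt0.
by lra.
Qed.

Lemma dyadic_subproof k : 2 ^- k \in (`[0, 1]%classic : set R).
Proof.
rewrite inE /= in_itv /= invr_ge0 exprn_ge0//= invf_le1 ?exprn_gt0//.
by rewrite exprn_ege1// ler1n.
Qed.

(** A backward orbit of 1 under the tent map, converging to the fixed point 0. *)
Definition dyadic k : I := exist _ (2 ^- k) (dyadic_subproof k).

Lemma zero_subproof : 0 \in (`[0, 1]%classic : set R).
Proof. by rewrite inE /= in_itv /= lexx ler01. Qed.

Definition zeroI : I := exist _ 0 zero_subproof.

Lemma iter_tent_zero n : iter n (@tent R) zeroI = zeroI.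
Proof.
elim: n => [//|n IHn]; rewrite iterS IHn; apply: val_inj => /=.
by rewrite mulr0 sub0r normrN normr1 subrr.
Qed.

Lemma tent_dyadic k : tent (dyadic k.+1) = dyadic k.
Proof.
have half : 2 * 2 ^- k.+1 = 2 ^- k :> R by rewrite exprS invfM mulrA mulfV ?mul1r.
apply: val_inj; change (1 - `|2 * 2 ^- k.+1 - 1| = 2 ^- k :> R); rewrite half.
have := dyadic_subproof k; rewrite inE /= in_itv /= => /andP[_ k1].
by rewrite ler0_norm ?subr_le0//; lra.
Qed.

Lemma iter_tent_dyadic n k : iter n (@tent R) (dyadic (n + k)) = dyadic k.
Proof. by elim: n => [//|n IHn]; rewrite iterSr addSn tent_dyadic. Qed.

(** Convergence to 0 is clear for the usual metric and passes to [d] through the common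
    neighbourhoods. *)
Lemma dyadic_near_zero (d : I -> I -> R) (e : R) : compatible_metric d -> 0 < e ->
  \forall k \near \oo, d zeroI (dyadic k) < e.
Proof.
move=> cd e0.
have : nbhs zeroI [set y | d zeroI y < e].
  by apply/(compatible_metric_nbhsP _ _ cd); exists e.
move=> /(compatible_metric_nbhsP _ _ compatible_interval_metric)[r r0 rP].
have half1 : `|2^-1 : R| < 1 by rewrite ger0_norm// invf_lt1// ltr1n.
have /cvgr0Pnorm_lt/(_ _ r0) := cvg_geometric 1 half1.
apply: filterS => k kr; apply: rP; change (`|0 - 2 ^- k : R| < r).
by rewrite sub0r normrN -exprVn -[_ ^+ _]mul1r.
Qed.

Section tent_modulus.
Variables (omega : nat -> R -> R) (d : I -> I -> R).
Hypotheses (momega : forall n, (0 < n)%N -> modulus (omega n)).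
Hypotheses (cd : compatible_metric d).
Hypothesis dT : forall n, (0 < n)%N -> admits d (omega n) (iter n (@tent R)).

Let D := d zeroI (dyadic 0).

Let D0 : 0 < D.
Proof.
rewrite lt_neqAle (metric_ge0 cd.1) andbT eq_sym; apply/eqP.
move=> /(metric_eq0 cd.1)/(congr1 set_val).
change (0 = 2 ^- 0 :> R -> False); rewrite expr0 invr1 => /esym/eqP.
by rewrite oner_eq0.
Qed.

(** Applying the [n]-th iterate to 0 and [2 ^- n] gives [D <= omega n (d zeroI (dyadic n))], and the
    argument eventually drops below any [t > 0]. *)
Lemma tent_modulus_liminf :
  exists c : R, 0 < c /\
    forall t : R, 0 < t -> (c%:E < limn_einf (fun n => (omega n t)%:E))%E.
Proof.
exists (D / 2); split=> [|t t0]; first by rewrite divr_gt0.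
apply: (@lt_le_trans _ _ D%:E); first by rewrite lte_fin; have := D0; lra.
apply: limn_einf_ge; near=> n.
have n0 : (0 < n)%N by near: n; exact: nbhs_infty_gt.
have := dT n0 zeroI (dyadic (n + 0)); rewrite iter_tent_zero iter_tent_dyadic.
move=> /le_trans; apply; rewrite addn0.
apply: (modulus_nondecreasing (momega n0)); first exact: (metric_ge0 cd.1).
by apply/ltW; near: n; exact: dyadic_near_zero.
Unshelve. all: by end_near.
Qed.

(* If [omega n] has slope at most 1 then [iter n tent] does not expand [d],
   although it maps points arbitrarily close to 0 to 1. *)
Lemma tent_modulus_derivative n : (0 < n)%N -> (1 < derivative0 (omega n))%E.
Proof.
move=> n0; rewrite ltNge; apply/negP => dn1.
have short t : 0 <= t -> omega n t <= t.
  rewrite le_eqVlt => /predU1P[<-|t0]; first by rewrite (modulus0 (momega n0)).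
  have := le_trans (derivative0_ge (momega n0) t0) dn1.
  by rewrite lee_fin ler_pdivrMr// mul1r.
(* Moving back along the orbit [n] steps at a time never decreases the distance to 0, against its
   convergence to 0. *)
have DM m : D <= d zeroI (dyadic (m * n)).
  elim: m => [//|m IHm]; apply: (le_trans IHm).
  have := dT n0 zeroI (dyadic (n + m * n)); rewrite iter_tent_zero iter_tent_dyadic.
  by rewrite mulSn => /le_trans; apply; apply: short; exact: (metric_ge0 cd.1).
have [N _ NP] := dyadic_near_zero cd D0.
by have := NP (N * n)%N (leq_pmulr _ n0); rewrite ltNge DM.
Qed.

End tent_modulus.

End tent_map.

(** * The cycle of implications *)

Theorem theorem2p7 (R : realType) (omega : nat -> R -> R)
    (homega : forall n, (0 < n)%N -> modulus (omega n)) :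
  [<->
    (* (i) *)
    (forall X : topologicalType, metrizable R X ->
      forall F : set (X -> X),
        (exists rho : X -> X -> R,
           compatible_metric rho /\ finitely_equicontinuous rho F) ->
        exists d : X -> X -> R, compatible_metric d /\
          forall n, (0 < n)%N -> family_admits d (omega n) (family_pow F n));
    (* (ii) *)
    (exists d : unit_interval R -> unit_interval R -> R,
       compatible_metric d /\
       forall n, (0 < n)%N -> admits d (omega n) (iter n (@tent R)));
    (* (iii) *)
    (exists phi : nat -> R -> R,
      [/\ forall n, (0 < n)%N -> simple_modulus (phi n),
          (forall n, (0 < n)%N -> (1 < derivative0 (phi n))%E) /\
            (derivative0 (phi n) @[n --> \oo] --> +oo%E),
          exists c : R, 0 < c /\
            forall n, (0 < n)%N ->
              (c%:E < ereal_sup [set (phi n t)%:E | t in [set t | (0 <= t)%R]])%E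
        & forall n t, (0 < n)%N -> 0 <= t -> phi n t <= omega n t]);
    (* (iv) *)
    ((exists c : R, 0 < c /\
        forall t : R, 0 < t -> (c%:E < limn_einf (fun n => (omega n t)%:E))%E) /\
     forall n, (0 < n)%N -> (1 < derivative0 (omega n))%E)].
Proof.
tfae.
- move=> /(_ (unit_interval R)) remetrize.
  have cI := @compatible_interval_metric R.
  have [||d [cd dT]] := remetrize _ [set @tent R].
  + by exists (@interval_metric R).
  + by exists (@interval_metric R); split=> //; exact: finitely_equicontinuous_tent.
  + exists d; split=> // n n0; apply: dT => //; by rewrite family_pow_set1.
- move=> [d [cd dT]].
  have [c [c0 cP]] := tent_modulus_liminf homega cd dT.
  have d1 := tent_modulus_derivative homega cd dT.
  have [a [c' min_le]] := truncated_minorant_liminf homega c0 cP d1.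
  exact: simple_truncated_minorant min_le.
- move=> [phi [sphi [dphi1 dphioo] [c [c0 cP]] phi_le]].
  have [a min_le] := truncated_minorant_simple c0 sphi dphi1 dphioo cP phi_le.
  exact: liminf_truncated_minorant min_le.
- move=> [[c [c0 cP]] d1] X _ F [rho [crho eqF]].
  have [a [c' min_le]] := truncated_minorant_liminf homega c0 cP d1.
  exact: remetrization min_le crho eqF.
Qed.
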